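(* Let $p>3$ be a prime and let $x\in\mathbb{Z}$. If $p\nmid x(x+1)(2x+1)$, then $$\sum_{k=0}^{p-1}(2k+1)P_k(2x+1)^4\equiv p+p^2\,\frac{(2x+1)^2\,q_p(2x+1)}{2x(x+1)}\pmod{p^3}.$$
   Context: $P_n$ denotes the $n$th Legendre polynomial, $P_n(t):=\sum_{k=0}^n\binom{n}{k}\binom{n+k}{k}\left(\frac{t-1}{2}\right)^k$. For an integer $a$ not divisible by $p$, $q_p(a):=(a^{p-1}-1)/p$ is the Fermat quotient. For rational numbers $u,v$, $u\equiv v\pmod{p^m}$ means that $u-v\in p^m\mathbb{Z}_{(p)}$, where $\mathbb{Z}_{(p)}$ is the ring of rationals with denominator not divisible by $p$. *)

(* Defs.v *)
From mathcomp Require Import all_boot all_order all_algebra.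
Set Implicit Arguments.
Unset Strict Implicit.
Unset Printing Implicit Defensive.
Import Order.TTheory GRing.Theory Num.Theory.
Local Open Scope ring_scope.

Definition legendre (n : nat) : {poly rat} :=
  \sum_(0 <= k < n.+1)
    ('C(n, k)%:R * 'C(n + k, k)%:R) *: (2^-1 *: ('X - 1)) ^+ k.

(* A rational number, equal to the usual integer when p is prime and does not divide a. *)
Definition fermat_quotient (p : nat) (a : int) : rat :=
  (a%:~R ^+ p.-1 - 1) / p%:R.

(* The ring Z_(p); denq is the positive denominator in lowest terms. *)
Definition Zlocal (p : nat) : pred rat := fun u => ~~ (p%:Z %| denq u)%Z.

Definition eqmod_local (p m : nat) (u v : rat) : Prop :=
  exists2 w : rat, w \in Zlocal p & u - v = p%:R ^+ m * w.

(* Main.v *)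
Require Import Defs.
From mathcomp Require Import all_boot all_order all_algebra.
From mathcomp Require Import ring zify.
Import Order.TTheory GRing.Theory Num.Theory.
Local Open Scope ring_scope.

(** Write u = x, y = u(u+1) and w = 2u+1, so that w^2 = 1 + 4y, and let
    Q_i(n) = C(n,i) C(n+i,i) ([legcoef]) and c_i = C(2i,i) ([central]).  The
    value P_n(2u+1) is the sum of the Q_i(n) u^i, and Clausen's formula
    ([legendre_sqr]) makes its square the sum of the c_i Q_i(n) y^i.  Hence

      sum_{n<p} (2n+1) P_n(w)^4 = sum_{i,j<p} c_i c_j y^(i+j) M(i,j),
      M(i,j) = sum_{n<p} (2n+1) Q_i(n) Q_j(n)   ([moment]).

    As a function of n, Q_i is a polynomial in n(n+1), and multiplying by
    n(n+1) in two ways gives a recurrence that trades an increment of j for an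
    increment of i ([moment_rec]).  The numbers p^2 (-1)^d / (d+1), d = i+j
    ([moment_main]), satisfy the same recurrence exactly, and for j = 0 the sum
    M(i,0) telescopes to a product that agrees with them modulo p^3.  Therefore
    M(i,j) = p^2 (-1)^d / (d+1) modulo p^3 as long as d < p
    ([moment_err_in_pow]).  The remaining pairs, i+j >= p, do not contribute:
    there p^2 divides M(i,j), and p divides c_i c_j because one of 2i, 2j is at
    least p ([moment_in_pow2], [centralM_in_pow1]).

    Since the c_i c_j with i+j = d add up to 4^d ([sum_central]), what is left is
    the sum over d < p of p^2 (-1)^d (4y)^d / (d+1), and
    p (-1)^d / (d+1) is C(p,d+1) modulo p^2.  By the binomial theorem the fourth
    power sum is p ((1+4y)^p - 1) / (4y) = p (w^(2p) - 1) / (4y) modulo p^3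
    ([sum_legendre4_in_pow]).  Substituting w^(p-1) = 1 + p q, with q the Fermat
    quotient of w, and dropping p^3 w^2 q^2 / (4y) gives the theorem. *)

(** * The square of a Legendre polynomial *)

Definition legcoef (n k : nat) : rat := 'C(n, k)%:R * 'C(n + k, k)%:R.

Lemma legcoef0 n : legcoef n 0 = 1.
Proof. by rewrite /legcoef !bin0 mulr1. Qed.

Lemma legcoef_small n k : (n < k)%N -> legcoef n k = 0.
Proof. by move=> ltnk; rewrite /legcoef bin_small ?mul0r. Qed.

(** This is the recurrence in k that makes [legcoef n k] a polynomial in n(n+1). *)
Lemma legcoefS n k :
  k.+1%:R ^+ 2 * legcoef n k.+1
  = (n%:R * (n%:R + 1) - k%:R * (k%:R + 1)) * legcoef n k.
Proof.
have [ltnk | lekn] := ltnP n k; first by rewrite !legcoef_small ?mulr0 // ltnW.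
have /(congr1 (fun m => m%:R : rat)) := mul_bin_left n k.
have /(congr1 (fun m => m%:R : rat)) := mul_bin_diag (n + k).+1 k.
rewrite !natrM natrB // succnK => H2 H1.
transitivity ((k.+1%:R * 'C(n, k.+1)%:R) * (k.+1%:R * 'C((n + k).+1, k.+1)%:R) : rat).
  by rewrite /legcoef addnS; ring.
by rewrite -H2 H1 /legcoef; ring.
Qed.

(** Legendre polynomials in the variable u = (t-1)/2, where their coefficients
    are the integers [legcoef n k]. *)
Definition delannoy (n : nat) : {poly rat} := \poly_(k < n.+1) legcoef n k.

Lemma coef_delannoy n k : (delannoy n)`_k = legcoef n k.
Proof. by rewrite coef_poly; case: ltnP => // /legcoef_small. Qed.

Lemma legendre_delannoy n (u : rat) :
  (legendre n).[2 * u + 1] = (delannoy n).[u].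
Proof.
rewrite /legendre /delannoy horner_poly horner_sum big_mkord.
apply: eq_bigr => k _; rewrite !hornerE; congr (_ * _ ^+ _); by field.
Qed.

(** Legendre's equation in the variable u; coefficientwise it is [legcoefS]. *)
Lemma delannoy_ode n (D := delannoy n) (m := n%:R * (n%:R + 1) : rat) :
  'X * ('X + 1) * D^`()^`() + (2 * 'X + 1) * D^`() - m%:P * D = 0.
Proof.
transitivity ('X * ('X * D^`()^`()) + 'X * D^`()^`() + 'X * D^`() *+ 2 + D^`() - m%:P * D).
  by ring.
apply/polyP=> k; rewrite coef0.
have := legcoefS n k; rewrite -/m.
move/eqP; rewrite -subr_eq0 => /eqP H; apply: etrans H.
rewrite coefB !coefD coefCM !coefXM !coef_deriv.
case: k => [|[|k]] /=; rewrite ?coef_deriv ?coef_delannoy; ring.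
Qed.

(** The symmetric square of Legendre's operator, of order three: it annihilates
    the product of any two solutions of y f'' + (2u+1) f' = m f, y = u(u+1). *)
Definition sym2_op (m : rat) (f : {poly rat}) : {poly rat} :=
  ('X * ('X + 1)) ^+ 2 * f^`()^`()^`()
  + 3 * ('X * ('X + 1)) * (2 * 'X + 1) * f^`()^`()
  + ((2 * 'X + 1) ^+ 2 + 2 * ('X * ('X + 1)) - 4 * m%:P * ('X * ('X + 1))) * f^`()
  - 2 * m%:P * (2 * 'X + 1) * f.

Lemma sym2_op_sqr (m : rat) (D : {poly rat}) :
  'X * ('X + 1) * D^`()^`() + (2 * 'X + 1) * D^`() - m%:P * D = 0 ->
  sym2_op m (D ^+ 2) = 0.
Proof.
move=> E.
have E' : 'X * ('X + 1) * D^`()^`()^`() + 2 * (2 * 'X + 1) * D^`()^`()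
          + (2 - m%:P) * D^`() = 0.
  by move: (congr1 (fun p => p^`()) E); rewrite !derivE => <-; ring.
(* The operator on D^2 is a combination of the equation and its derivative. *)
transitivity (
  2 * ('X * ('X + 1)) * D * ('X * ('X + 1) * D^`()^`()^`() + 2 * (2 * 'X + 1) * D^`()^`()
    + (2 - m%:P) * D^`())
  + (6 * ('X * ('X + 1)) * D^`() + 2 * (2 * 'X + 1) * D)
    * ('X * ('X + 1) * D^`()^`() + (2 * 'X + 1) * D^`() - m%:P * D)).
  by rewrite /sym2_op !expr2 !derivE; ring.
by rewrite E E' !mulr0 addr0.
Qed.

(** The symmetric square changes sign under u -> -1-u, so on polynomials in
    y = u(u+1) it is 2u+1 times an operator in y; that operator relates only
    consecutive coefficients. *)
Lemma sym2_op_comp (m : rat) (r : {poly rat}) :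
  'X ^+ 2 * (4 * 'X + 1) * r^`()^`()^`() + 3 * 'X * (6 * 'X + 1) * r^`()^`()
  + (12 * 'X + 1 - 4 * m%:P * 'X) * r^`() - 2 * m%:P * r = 0 ->
  sym2_op m (r \Po ('X * ('X + 1))) = 0.
Proof.
move=> /(congr1 (fun p => (2 * 'X + 1) * (p \Po ('X * ('X + 1))))).
rewrite comp_poly0 mulr0 => <-.
rewrite /sym2_op !(deriv_comp, derivE) /=.
rewrite !(comp_polyB, comp_polyD, comp_polyM, comp_polyC, comp_polyX, polyC1) /=.
ring.
Qed.

(** The indicial equation at u = 0 is k^3 = 0, so a polynomial solution is
    determined by its constant term. *)
Lemma sym2_op_inj (m : rat) (f : {poly rat}) :
  sym2_op m f = 0 -> f`_0%N = 0 -> f = 0.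
Proof.
move=> E f0.
(* Iterated products by the variable, so that coefficients can be read off. *)
have {E} : 'X * ('X * f^`()^`()^`()) + 'X * ('X * ('X * f^`()^`()^`())) *+ 2
   + 'X * ('X * ('X * ('X * f^`()^`()^`())))
   + ('X * f^`()^`() *+ 3 + 'X * ('X * f^`()^`()) *+ 9 + 'X * ('X * ('X * f^`()^`())) *+ 6)
   + (f^`() + (6 - 4 * m)%:P * ('X * f^`()) + (6 - 4 * m)%:P * ('X * ('X * f^`()))
   - (2 * m)%:P * f - (4 * m)%:P * ('X * f)) = 0.
  by rewrite -[RHS]E /sym2_op !(polyCB, polyCM, polyC_natr) /=; ring.
move=> /polyP E.
suff H k : f`_k = 0 /\ f`_k.+1 = 0 by apply/polyP=> k; rewrite coef0; case: (H k).
elim: k => [|k [fk fk1]]; split=> //.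
  move: (E 0%N); rewrite coef0 !(coefD, coefN, coefCM, coefXM, coef_deriv) /=.
  rewrite f0.
  by move=> H; apply: etrans H; ring.
suff /eqP : k.+2%:R ^+ 3 * f`_k.+2 = 0.
  by rewrite mulf_eq0 expf_eq0 /= pnatr_eq0 /= => /eqP.
move: (E k.+1); rewrite coef0 => H; apply: etrans H; clear E.
rewrite !(coefD, coefN, coefCM, coefXM).
case: k fk fk1 => [|[|[|k]]] /= fk fk1; rewrite ?coef_deriv ?fk ?fk1; ring.
Qed.

Definition central (i : nat) : rat := 'C(i.*2, i)%:R.

Lemma central0 : central 0 = 1. Proof. by []. Qed.

Lemma centralS i : i.+1%:R * central i.+1 = 2 * (2 * i%:R + 1) * central i.
Proof.
have E : (i.+1 * 'C(i.+1.*2, i.+1) = 2 * (2 * i + 1) * 'C(i.*2, i))%N.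
  have := mul_bin_diag i.*2.+2 i; have := mul_bin_diag i.*2.+1 i.
  rewrite !succnK doubleS.
  have -> : 'C(i.*2.+1, i.+1) = 'C(i.*2.+1, i).
    by rewrite -[RHS]bin_sub; [congr binomial|]; lia.
  rewrite -mul2n; lia.
by rewrite /central -natrM E natrM natrM natrD natrM.
Qed.

Definition sqr_coef (n i : nat) : rat := central i * legcoef n i.

(** Clausen's formula: both sides are annihilated by the symmetric square and
    have constant term 1. *)
Lemma delannoy_sqr n :
  delannoy n ^+ 2 = (\poly_(i < n.+1) sqr_coef n i) \Po ('X * ('X + 1)).
Proof.
set r := \poly_(i < _) _.
have rE k : r`_k = sqr_coef n k.
  by rewrite coef_poly; case: ltnP => // ltnk; rewrite /sqr_coef legcoef_small ?mulr0.
pose m : rat := n%:R * (n%:R + 1).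
apply/eqP; rewrite -subr_eq0; apply/eqP; apply: (@sym2_op_inj m).
  have -> : forall f g, sym2_op m (f - g) = sym2_op m f - sym2_op m g.
    by move=> f g; rewrite /sym2_op !derivB; ring.
  rewrite sym2_op_sqr ?sym2_op_comp ?subrr //; last exact: delannoy_ode.
  transitivity (4 * ('X * ('X * ('X * r^`()^`()^`()))) + 'X * ('X * r^`()^`()^`())
      + 18 * ('X * ('X * r^`()^`())) + 3 * ('X * r^`()^`())
      + (12 - 4 * m)%:P * ('X * r^`()) + r^`() - (2 * m)%:P * r).
    by rewrite !(polyCB, polyCM, polyC_natr) /=; ring.
  apply/polyP=> k; rewrite coef0.
  have : k.+1%:R ^+ 3 * r`_k.+1 - 2 * (2 * k%:R + 1) * (m - k%:R * (k%:R + 1)) * r`_k = 0.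
    rewrite !rE /sqr_coef.
    transitivity ((k.+1%:R * central k.+1) * (k.+1%:R ^+ 2 * legcoef n k.+1)
       - 2 * (2 * k%:R + 1) * (m - k%:R * (k%:R + 1)) * (central k * legcoef n k)).
      by ring.
    by rewrite centralS legcoefS -/m; ring.
  move=> H; apply: etrans H.
  rewrite -!polyC_natr !(coefD, coefN, coefCM, coefXM).
  by case: k => [|[|[|k]]] /=; rewrite ?coef_deriv; ring.
rewrite coefB -!horner_coef0 horner_exp horner_comp !hornerE.
by rewrite !horner_coef0 coef_delannoy rE /sqr_coef central0 legcoef0; ring.
Qed.

Lemma legendre_sqr n N (u : rat) : (n < N)%N ->
  (legendre n).[2 * u + 1] ^+ 2 = \sum_(0 <= i < N) sqr_coef n i * (u * (u + 1)) ^+ i.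
Proof.
move=> ltnN; rewrite legendre_delannoy -horner_exp delannoy_sqr horner_comp !hornerE.
rewrite (@horner_coef_wide _ N) ?(leq_trans (size_poly _ _)) // big_mkord.
apply: eq_bigr => i _; rewrite coef_poly.
by case: ltnP => // ltni; rewrite /sqr_coef legcoef_small ?mulr0.
Qed.

(** * Divisibility by powers of p in the local ring *)

Section PadicOrder.
Variables (p : nat) (p_pr : prime p).

(** Membership in the ideal p^m Z_(p), with a denominator that need not be in
    lowest terms, which makes closure under the ring operations immediate. *)
Definition in_pow (m : nat) (u : rat) : Prop :=
  exists a b : int, ~~ (p%:Z %| b)%Z /\ b%:~R * u = p%:R ^+ m * a%:~R.

Lemma prime_dvdzM (a b : int) :
  (p%:Z %| a * b)%Z = (p%:Z %| a)%Z || (p%:Z %| b)%Z.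
Proof. by rewrite !dvdzE abszM Euclid_dvdM. Qed.

Lemma ndvdz1 : ~~ (p%:Z %| 1)%Z.
Proof. by rewrite dvdzE dvdn1 neq_ltn prime_gt1 ?orbT. Qed.

Lemma ndvdz_neq0 (b : int) : ~~ (p%:Z %| b)%Z -> b%:~R != 0 :> rat.
Proof. by rewrite intr_eq0; apply: contraNneq => ->; rewrite dvdz0. Qed.

Lemma in_pow_eqmod m u v : in_pow m (u - v) -> eqmod_local p m u v.
Proof.
case=> a [b [pNb E]]; have b0 := ndvdz_neq0 _ pNb.
exists (a%:~R / b%:~R); last first.
  by apply: (mulfI b0); rewrite E; field.
rewrite unfold_in /Zlocal; apply/negP=> pd.
set w := a%:~R / b%:~R in pd *.
have /eqP : (numq w * b)%:~R = (a * denq w)%:~R :> rat.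
  by rewrite !intrM numqE /w; field.
rewrite eqr_int => /eqP ab.
have : (p%:Z %| numq w * b)%Z by rewrite ab dvdz_mull.
rewrite prime_dvdzM (negPf pNb) orbF => pn.
have := coprime_num_den w; rewrite /coprime => /eqP cop.
have : (p %| gcdn `|numq w| `|denq w|)%N.
  by rewrite dvdn_gcd; move: pn pd; rewrite !dvdzE /= => -> ->.
by rewrite cop; apply/negP; have := ndvdz1; rewrite dvdzE.
Qed.

Lemma in_pow0 m : in_pow m 0.
Proof. by exists 0, 1; rewrite ndvdz1 !mulr0. Qed.

Lemma in_powD m u v : in_pow m u -> in_pow m v -> in_pow m (u + v).
Proof.
move=> [a [b [Nb E]]] [c [d [Nd F]]]; exists (a * d + c * b), (b * d).
rewrite prime_dvdzM negb_or Nb Nd; split=> //.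
transitivity (d%:~R * (b%:~R * u) + b%:~R * (d%:~R * v)); first by ring.
by rewrite E F; ring.
Qed.

Lemma in_powM m k u v : in_pow m u -> in_pow k v -> in_pow (m + k) (u * v).
Proof.
move=> [a [b [Nb E]]] [c [d [Nd F]]]; exists (a * c), (b * d).
rewrite prime_dvdzM negb_or Nb Nd; split=> //.
transitivity ((b%:~R * u) * (d%:~R * v)); first by ring.
by rewrite E F exprD; ring.
Qed.

Lemma in_pow_int (a : int) : in_pow 0 a%:~R.
Proof. by exists a, 1; rewrite ndvdz1. Qed.

Lemma in_pow_dvdn k : (p %| k)%N -> in_pow 1 k%:R.
Proof.
move=> /dvdnP[q ->]; exists q%:Z, 1; rewrite ndvdz1; split=> //.
by rewrite mul1r natrM mulrC.
Qed.

Lemma in_pow_pX m : in_pow m (p%:R ^+ m).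
Proof. by exists 1, 1; rewrite ndvdz1 mulr1 mul1r. Qed.

Lemma in_powW m k u : (k <= m)%N -> in_pow m u -> in_pow k u.
Proof.
move=> lekm [a [b [Nb E]]]; exists (p%:Z ^+ (m - k) * a), b; split=> //.
by rewrite E -{1}(subnKC lekm) exprD intrM rmorphXn mulrA.
Qed.

Lemma in_powMl m u v : in_pow 0 u -> in_pow m v -> in_pow m (u * v).
Proof. exact: in_powM. Qed.

Lemma in_pow_nat k : in_pow 0 k%:R.
Proof. exact: (in_pow_int k%:Z). Qed.

Lemma in_powX u n : in_pow 0 u -> in_pow 0 (u ^+ n).
Proof.
move=> u0; elim: n => [|n IH]; first by rewrite expr0; exact: (in_pow_nat 1).
by rewrite exprS; apply: in_powMl.
Qed.

Lemma in_pow_sign n : in_pow 0 ((-1) ^+ n).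
Proof. by apply: in_powX; exact: (in_pow_int (-1)). Qed.

Lemma in_powN m u : in_pow m u -> in_pow m (- u).
Proof. by move=> mu; rewrite -mulN1r; apply: in_powMl => //; apply: (in_pow_int (-1)). Qed.

Lemma in_powB m u v : in_pow m u -> in_pow m v -> in_pow m (u - v).
Proof. by move=> mu mv; apply/in_powD/in_powN. Qed.

Lemma in_pow_sum m (I : Type) (r : seq I) (P : pred I) (F : I -> rat) :
  (forall i, P i -> in_pow m (F i)) -> in_pow m (\sum_(i <- r | P i) F i).
Proof. by move=> PF; elim/big_ind: _ => //; [exact: in_pow0 | exact: in_powD]. Qed.

Lemma in_pow_cancel m (b : int) u :
  ~~ (p%:Z %| b)%Z -> in_pow m (b%:~R * u) -> in_pow m u.
Proof.
move=> Nb [a [d [Nd E]]]; exists a, (d * b).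
by rewrite prime_dvdzM negb_or Nb Nd -E intrM mulrA.
Qed.

Lemma in_pow_inv (b : int) : ~~ (p%:Z %| b)%Z -> in_pow 0 b%:~R^-1.
Proof.
move=> Nb; apply: (in_pow_cancel _ b _ Nb); rewrite divff; last exact: ndvdz_neq0.
exact: (in_pow_nat 1).
Qed.

Lemma ndvdz_small k : (0 < k < p)%N -> ~~ (p%:Z %| k%:Z)%Z.
Proof.
by move=> /andP[k0 kp]; rewrite dvdzE /=; apply/negP=> /dvdn_leq; lia.
Qed.

(** A single factor p compensates every denominator that occurs below, including
    the denominator p itself. *)
Lemma in_pow_p_div k : (0 < k <= p)%N -> in_pow 0 (p%:R / k%:R).
Proof.
move=> /andP[k0]; rewrite leq_eqVlt => /orP[/eqP-> | ltkp].
  by rewrite divff ?pnatr_eq0 -?lt0n ?prime_gt0 //; apply: (in_pow_int 1).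
apply: in_powMl; first exact: in_pow_nat.
by apply: (@in_pow_inv k%:Z); rewrite ndvdz_small ?k0.
Qed.

(** * Moments of the coefficients modulo powers of p *)

Lemma legcoefSn n i :
  (n%:R + 1 - i%:R) * legcoef n.+1 i = (n%:R + 1 + i%:R) * legcoef n i.
Proof.
have [ltni | lein] := ltnP n i.
  rewrite (legcoef_small n) // mulr0.
  have [->|neq] := eqVneq i n.+1; first by rewrite -natr1 subrr mul0r.
  by rewrite legcoef_small ?mulr0 //; lia.
have /(congr1 (fun m => m%:R : rat)) := mul_bin_down n.+1 i.
have /(congr1 (fun m => m%:R : rat)) := mul_bin_down (n + i).+1 i.
rewrite !natrM !succnK -addSn addnK natrB ?leqW // natrD -natr1 => H2 H1.
have n0 : n%:R + 1 != 0 :> rat by rewrite natr1 pnatr_eq0.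
apply: (mulfI n0); rewrite /legcoef.
transitivity (((n%:R + 1 - i%:R) * 'C(n.+1, i)%:R) * ((n%:R + 1) * 'C(n.+1 + i, i)%:R) : rat).
  by ring.
by rewrite -H1 -H2; ring.
Qed.

(** The sum telescopes because of [legcoefSn]. *)
Lemma sum_legcoef N i :
  i.+1%:R * (\sum_(0 <= n < N) (2 * n + 1)%:R * legcoef n i)
  = N%:R * ((N%:R - i%:R) * legcoef N i).
Proof.
elim: N => [|N IH]; first by rewrite big_nil mulr0 mul0r.
rewrite big_nat_recr //= mulrDr IH -[N.+1%:R]natr1 legcoefSn natrD natrM; ring.
Qed.

Definition moment (i j : nat) : rat :=
  \sum_(0 <= n < p) (2 * n + 1)%:R * (legcoef n i * legcoef n j).

(** Both products [legcoef n i * legcoef n j.+1] and [legcoef n i.+1 * legcoef n j]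
    express n(n+1) times [legcoef n i * legcoef n j], up to multiples of the
    latter; the difference of the two expressions is the recurrence. *)
Lemma moment_rec i j :
  j.+1%:R ^+ 2 * moment i j.+1 = i.+1%:R ^+ 2 * moment i.+1 j
    + (i%:R * (i%:R + 1) - j%:R * (j%:R + 1)) * moment i j.
Proof.
rewrite /moment !big_distrr -big_split /=; apply: eq_bigr => n _.
transitivity ((2 * n + 1)%:R * (legcoef n i * (j.+1%:R ^+ 2 * legcoef n j.+1))).
  by ring.
rewrite legcoefS.
transitivity ((2 * n + 1)%:R * ((i.+1%:R ^+ 2 * legcoef n i.+1) * legcoef n j)
   + (i%:R * (i%:R + 1) - j%:R * (j%:R + 1))
     * ((2 * n + 1)%:R * (legcoef n i * legcoef n j))); last by ring.
by rewrite legcoefS; ring.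
Qed.

Lemma moment_vanish i j : (p <= i)%N -> moment i j = 0.
Proof.
move=> lepi; rewrite /moment big_nat big1 // => n /andP[_ ltnp].
by rewrite legcoef_small ?mul0r ?mulr0 // (leq_trans ltnp).
Qed.

(** This is p^2 (-1)^d / (d+1), grouped so that p / (d+1) is visibly p-integral
    for d < p. *)
Definition moment_main (d : nat) : rat := p%:R * ((-1) ^+ d * (p%:R / d.+1%:R)).

Definition moment_err i j := moment i j - moment_main (i + j).

Lemma moment_err_rec i j :
  j.+1%:R ^+ 2 * moment_err i j.+1 = i.+1%:R ^+ 2 * moment_err i.+1 j
    + (i%:R * (i%:R + 1) - j%:R * (j%:R + 1)) * moment_err i j.
Proof.
rewrite /moment_err mulrBr moment_rec addnS addSn /moment_main [(-1) ^+ _.+1]exprS.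
move: (moment i.+1 j) (moment i j) ((-1) ^+ (i + j)) => M1 M2 e.
have d1 : (i + j).+1%:R != 0 :> rat by rewrite pnatr_eq0.
have d2 : (i + j).+2%:R != 0 :> rat by rewrite pnatr_eq0.
by field; rewrite -natrD nat1r -natrD !pnatr_eq0.
Qed.

Lemma in_pow_sqr_cancel m j u :
  (j.+1 < p)%N -> in_pow m (j.+1%:R ^+ 2 * u) -> in_pow m u.
Proof.
move=> ltjp H; do 2!apply: (in_pow_cancel _ j.+1%:Z _ (ndvdz_small _ _)) => //.
by rewrite mulrA.
Qed.

(** Up to sign, (p-i) Q_i(p) is p times
    prod_(1 <= s <= i) (1 - p^2/s^2); [legcoefS] at n = p supplies one factor per
    step. *)
Lemma legcoef_p i : (i < p)%N ->
  in_pow 3 ((p%:R - i%:R) * legcoef p i - (-1) ^+ i * p%:R).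
Proof.
elim: i => [|i IH] ltip.
  by rewrite legcoef0 subr0 mulr1 mul1r subrr; exact: in_pow0.
have {}IH := IH (ltnW ltip); set V := (p%:R - i%:R) * legcoef p i in IH.
apply: (in_pow_sqr_cancel _ _ _ ltip).
have -> : i.+1%:R ^+ 2 * ((p%:R - i.+1%:R) * legcoef p i.+1 - (-1) ^+ i.+1 * p%:R)
   = p%:R ^+ 2 * V - i.+1%:R ^+ 2 * (V - (-1) ^+ i * p%:R).
  rewrite [(-1) ^+ _]exprS mulrBr mulrCA legcoefS /V; ring.
apply: in_powB; last by apply: in_powMl => //; apply/in_powX/in_pow_nat.
apply: (in_powM 2 1); first exact: in_pow_pX.
rewrite -(subrK ((-1) ^+ i * p%:R) V); apply: in_powD; first exact: in_powW IH.
apply: in_powMl; last exact: (in_pow_pX 1).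
exact: in_pow_sign.
Qed.

(** The recurrence solves for the moment with the larger j after division by
    (j+1)^2, a unit; it starts from the telescoping sums at j = 0. *)
Lemma moment_err_in_pow i j : (i + j < p)%N -> in_pow 3 (moment_err i j).
Proof.
elim: j i => [|j IH] i ltijp.
  rewrite addn0 in ltijp.
  have -> : moment_err i 0 = p%:R / i.+1%:R * ((p%:R - i%:R) * legcoef p i - (-1) ^+ i * p%:R).
    have i0 : i.+1%:R != 0 :> rat by rewrite pnatr_eq0.
    apply: (mulfI i0); rewrite /moment_err mulrBr /moment addn0.
    under eq_bigr => n _ do rewrite legcoef0 mulr1.
    by rewrite sum_legcoef /moment_main; field; rewrite nat1r.
  by apply: in_powMl; [exact: in_pow_p_div | exact: legcoef_p].
have ltjp : (j.+1 < p)%N by lia.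
apply: (in_pow_sqr_cancel _ _ _ ltjp); rewrite moment_err_rec.
apply: in_powD; apply: in_powMl; try (apply: IH; lia).
  exact/in_powX/in_pow_nat.
by apply: in_powB; apply: in_powMl; rewrite ?natr1; exact: in_pow_nat.
Qed.

Lemma moment_in_pow1 i j : (i + j < p)%N -> in_pow 1 (moment i j).
Proof.
move=> ltijp; rewrite -[moment i j](subrK (moment_main (i + j))).
apply: in_powD; first exact: in_powW (moment_err_in_pow _ _ ltijp).
apply: (in_powM 1 0); first exact: (in_pow_pX 1).
by apply: in_powMl; [exact: in_pow_sign | exact: in_pow_p_div].
Qed.

(** The recurrence has the factor i+j+1 in front of [moment i j].  When a step
    enters the range from i+j = p-1, this factor is p and supplies the power that
    [moment_in_pow1] lacks; at j = 0 the moments vanish. *)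
Lemma moment_in_pow2 i j : (j < p)%N -> (p <= i + j)%N -> in_pow 2 (moment i j).
Proof.
elim: j i => [|j IH] i ltjp lep.
  by rewrite moment_vanish; [exact: in_pow0 | rewrite -(addn0 i)].
apply: (in_pow_sqr_cancel _ _ _ ltjp); rewrite moment_rec.
apply: in_powD.
  by apply: in_powMl; [exact/in_powX/in_pow_nat | apply: IH; lia].
have -> : i%:R * (i%:R + 1) - j%:R * (j%:R + 1) = (i%:R - j%:R) * (i + j).+1%:R :> rat by ring.
rewrite -mulrA; apply: in_powMl; first by apply: in_powB; exact: in_pow_nat.
have [lepij | ltijp] := leqP p (i + j).
  by apply: in_powMl; [exact: in_pow_nat | apply: IH => //; lia].
apply: (in_powM 1 1); last exact: moment_in_pow1.
by apply: in_pow_dvdn; have -> : (i + j).+1 = p by lia.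
Qed.

Lemma ndvdn_fact k : (k < p)%N -> ~~ (p %| k`!)%N.
Proof.
elim: k => [|k IH] ltkp; first by rewrite dvdn1 neq_ltn prime_gt1 ?orbT.
rewrite factS Euclid_dvdM // negb_or IH ?andbT; last exact: ltnW.
by apply/negP=> /dvdn_leq; lia.
Qed.

(** The prime p divides (2i)! but not (i!)^2. *)
Lemma central_in_pow1 i : (i < p)%N -> (p <= i.*2)%N -> in_pow 1 (central i).
Proof.
move=> ltip lep; apply: in_pow_dvdn.
have := ndvdn_fact _ ltip => Ni.
have : (p %| (i.*2)`!)%N by apply: dvdn_fact; rewrite prime_gt0.
rewrite -(@bin_fact i.*2 i) -addnn ?leq_addr // addnK.
by rewrite !Euclid_dvdM // (negPf Ni) !orbF.
Qed.

Lemma centralM_in_pow1 i j : (i < p)%N -> (j < p)%N -> (p <= i + j)%N ->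
  in_pow 1 (central i * central j).
Proof.
move=> ltip ltjp lep; have [lei | lti] := leqP p i.*2.
  by apply: (in_powM 1 0); [exact: central_in_pow1 | exact: in_pow_nat].
by apply: in_powMl; [exact: in_pow_nat | apply: central_in_pow1 => //; lia].
Qed.

End PadicOrder.

(** * Two summation identities *)

Lemma sum_triangle (V : nmodType) N (g : nat -> nat -> V) :
  \sum_(0 <= i < N) \sum_(0 <= j < N | (i + j < N)%N) g i j
  = \sum_(0 <= d < N) \sum_(0 <= i < d.+1) g i (d - i)%N.
Proof.
transitivity (\sum_(0 <= i < N) \sum_(0 <= d < N | (i <= d)%N) g i (d - i)%N).
  apply: eq_big_nat => i /andP[_ ltiN].
  transitivity (\sum_(i <= d < N) g i (d - i)%N); last by rewrite (big_nat_widenl _ 0).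
  rewrite -[X in \sum_(X <= _ < _) _]add0n big_addn.
  rewrite (big_nat_widen _ (N - i) N) ?leq_subr //.
  by apply: eq_big => [j | j _]; [lia | rewrite addnK].
rewrite (exchange_big_dep_nat xpredT) //=; apply: eq_big_nat => d /andP[_ ltdN].
by rewrite [RHS](big_nat_widen _ _ N).
Qed.

(** The square of the generating function of the central binomial coefficients is
    1/(1-4z).  Here the symmetry i <-> d-i evaluates the sum weighted by i as d/2
    times the sum, and [centralS] turns that into a factor 4 from d to d+1. *)
Lemma sum_central d :
  \sum_(0 <= i < d.+1) central i * central (d - i) = 4 ^+ d.
Proof.
pose S d := \sum_(0 <= i < d.+1) central i * central (d - i).
pose T d := \sum_(0 <= i < d.+1) i%:R * (central i * central (d - i)).
have TS k : 2 * T k = k%:R * S k.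
  rewrite mulr2n mulrDl mul1r {2}/T big_nat_rev /= -big_split /S big_distrr /=.
  apply: eq_big_nat => i /andP[_ leik].
  rewrite add0n subSS subKn // natrB //; ring.
rewrite -/(S d); elim: d => [|d IH].
  by rewrite /S big_nat1 central0 mulr1.
have d0 : d.+1%:R != 0 :> rat by rewrite pnatr_eq0.
apply: (mulfI d0); rewrite -TS /T big_nat_recl // mul0r add0r.
under eq_bigr => i _ do rewrite mulrA centralS subSS.
transitivity (2 * (4 * T d + 2 * S d)).
  congr (2 * _); rewrite /T /S !big_distrr -big_split /=; apply: eq_bigr => i _; ring.
by rewrite exprS -IH mulrDr mulrCA TS -natr1; ring.
Qed.

(** * The fourth power sum modulo p^3 *)

Section Congruence.
Variables (p : nat) (p_pr : prime p).

Lemma bin_pred_in_pow1 d : (d < p)%N ->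
  in_pow p 1 ((-1) ^+ d - 'C(p.-1, d)%:R).
Proof.
elim: d => [|d IH] ltdp; first by rewrite bin0 subrr; exact: in_pow0.
apply: (in_pow_cancel _ p_pr _ d.+1%:Z); first exact: ndvdz_small.
have -> : d.+1%:~R * ((-1) ^+ d.+1 - 'C(p.-1, d.+1)%:R)
   = - (d.+1%:R * ((-1) ^+ d - 'C(p.-1, d)%:R)) - p%:R * 'C(p.-1, d)%:R :> rat.
  rewrite mulrBr -[d.+1%:~R]/(d.+1%:R) -[X in _ - X = _]natrM mul_bin_left natrM.
  have -> : p%:R = p.-1%:R + 1 :> rat by rewrite natr1 prednK ?prime_gt0.
  by rewrite natrB ?exprS; [ring | lia].
apply: in_powB => //; last first.
  by apply: (in_powM _ _ 1 0) => //; [exact: (in_pow_pX _ _ 1) | exact: in_pow_nat].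
by apply: in_powN => //; apply: in_powMl => //; [exact: in_pow_nat | exact/IH/ltnW].
Qed.

Lemma moment_main_bin d : odd p -> (d < p)%N ->
  in_pow p 3 (moment_main p d - p%:R * 'C(p, d.+1)%:R).
Proof.
move=> p_odd ltdp.
have -> : moment_main p d - p%:R * 'C(p, d.+1)%:R
   = p%:R * (p%:R / d.+1%:R * ((-1) ^+ d - 'C(p.-1, d)%:R)).
  have d0 : d.+1%:R != 0 :> rat by rewrite pnatr_eq0.
  apply: (mulfI d0); rewrite mulrBr mulrCA [X in _ - X]mulrCA -[X in _ - _ * X]natrM -mul_bin_diag.
  by rewrite natrM /moment_main; field; rewrite nat1r.
apply: (in_powM _ p_pr 1 2); first exact: (in_pow_pX _ _ 1).
have [->|neq] := eqVneq d p.-1.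
  (* Here d+1 = p is not invertible, but the two terms agree exactly, p being odd. *)
  rewrite binn -signr_odd -subn1 oddB ?prime_gt0 // p_odd subrr mulr0; exact: in_pow0.
apply: (in_powM _ p_pr 1 1); last exact: bin_pred_in_pow1.
apply: (in_powM _ p_pr 1 0); first exact: (in_pow_pX _ _ 1).
by apply: (in_pow_inv _ _ d.+1%:Z) => //; apply: ndvdz_small; lia.
Qed.

Lemma fermat_int (a : int) : odd p -> exists b : int,
  a%:~R ^+ p - a%:~R = p%:R * b%:~R :> rat.
Proof.
move=> p_odd.
have Fn n : exists b : int, n%:R ^+ p - n%:R = p%:R * b%:~R :> rat.
  have le : (n <= n ^ p)%N by case: n => // n; apply: leq_pexp2l (prime_gt0 _).
  have /eqP := fermat_little n p_pr; rewrite eqn_mod_dvd // => /dvdnP[q E].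
  by exists q%:Z; rewrite -natrX -natrB // E natrM mulrC.
case: a => n; first exact: Fn.
have [b E] := Fn n.+1; exists (- b); rewrite NegzE !rmorphN /= mulrN -E.
by rewrite exprNn -signr_odd p_odd -[n.+1%:~R]/(n.+1%:R); ring.
Qed.

Lemma sum_legendre4 (u : rat) (y := u * (u + 1)) :
  \sum_(0 <= n < p) (2 * n + 1)%:R * (legendre n).[2 * u + 1] ^+ 4
  = \sum_(0 <= i < p) \sum_(0 <= j < p)
      central i * central j * y ^+ (i + j) * moment p i j.
Proof.
have sqr n : (n < p)%N -> (legendre n).[2 * u + 1] ^+ 4 =
  \sum_(0 <= i < p) \sum_(0 <= j < p)
    central i * central j * y ^+ (i + j) * (legcoef n i * legcoef n j).
  move=> ltnp; rewrite (exprM _ 2 2) (legendre_sqr _ _ _ ltnp) expr2 mulr_suml.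
  apply: eq_bigr => i _; rewrite mulr_sumr; apply: eq_bigr => j _.
  by rewrite /sqr_coef exprD -/y; ring.
rewrite big_nat; under eq_bigr => n /andP[_ ltnp] do rewrite sqr // mulr_sumr.
rewrite -big_nat exchange_big /=; apply: eq_bigr => i _.
under eq_bigr => n _ do rewrite mulr_sumr.
rewrite exchange_big /=; apply: eq_bigr => j _.
by rewrite /moment mulr_sumr; apply: eq_bigr => n _; ring.
Qed.

(** The double sum is compared with its part i+j < p, in which the moments are
    replaced by [moment_main]; that part is then summed along i+j = d. *)
Lemma sum_legendre4_in_pow (x : int) (u : rat := x%:~R) (y : rat := u * (u + 1)) : odd p ->
  in_pow p 3 (\sum_(0 <= n < p) (2 * n + 1)%:R * (legendre n).[2 * u + 1] ^+ 4
     - p%:R * \sum_(0 <= d < p) 'C(p, d.+1)%:R * (4 * y) ^+ d).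
Proof.
move=> p_odd.
have y0 k : in_pow p 0 (y ^+ k).
  apply: in_powX => //; have -> : y = (x * (x + 1))%:~R by rewrite intrM intrD.
  exact: in_pow_int.
have -> : p%:R * (\sum_(0 <= d < p) 'C(p, d.+1)%:R * (4 * y) ^+ d)
  = \sum_(0 <= d < p) moment_main p d * (4 * y) ^+ d
    - \sum_(0 <= d < p) (moment_main p d - p%:R * 'C(p, d.+1)%:R) * (4 * y) ^+ d.
  by rewrite mulr_sumr -sumrB; apply: eq_bigr => d _; ring.
rewrite opprB addrA addrAC; apply: in_powD => //; last first.
  rewrite big_nat; apply: in_pow_sum => // d /andP[_ ltdp].
  apply: (in_powM _ p_pr 3 0); first exact: moment_main_bin.
  by rewrite exprMn; apply: in_powMl => //; apply: in_powX => //; exact: in_pow_nat.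
have -> : \sum_(0 <= d < p) moment_main p d * (4 * y) ^+ d
   = \sum_(0 <= i < p) \sum_(0 <= j < p) (if (i + j < p)%N then
        central i * central j * y ^+ (i + j) * moment_main p (i + j) else 0).
  under [RHS]eq_bigr => i _ do rewrite -big_mkcond.
  rewrite sum_triangle; apply: eq_bigr => d _.
  rewrite exprMn -sum_central mulr_suml mulr_sumr; apply: eq_big_nat => i /andP[_ leid].
  by rewrite subnKC //; ring.
rewrite sum_legendre4 -/y -sumrB big_nat; apply: in_pow_sum => // i /andP[_ ltip].
rewrite -sumrB big_nat; apply: in_pow_sum => // j /andP[_ ltjp].
have cc0 : in_pow p 0 (central i * central j * y ^+ (i + j)).
  by apply: in_powMl => //; apply: in_powMl => //; exact: in_pow_nat.
case: ltnP => [ltij | lep].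
  by rewrite -mulrBr; apply: in_powMl => //; exact: moment_err_in_pow.
rewrite subr0; apply: (in_powM _ p_pr 1 2); last exact: moment_in_pow2.
by apply: (in_powM _ p_pr 1 0) => //; exact: centralM_in_pow1.
Qed.

Lemma sum_bin_shift (z : rat) :
  z * (\sum_(0 <= d < p) 'C(p, d.+1)%:R * z ^+ d) = (1 + z) ^+ p - 1.
Proof.
rewrite exprDn big_ord_recl /= subn0 expr1n mul1r bin0 mulr1n addrAC subrr add0r.
rewrite mulr_sumr big_mkord; apply: eq_bigr => d _.
by rewrite /bump leq0n add1n expr1n mul1r exprS -mulr_natl; ring.
Qed.

End Congruence.

Theorem corollary1 (p : nat) (x : int) :
  prime p -> (3 < p)%N ->
  ~~ (p%:Z %| x * (x + 1) * (2 * x + 1))%Z ->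
  eqmod_local p 3
    (\sum_(0 <= k < p) (2 * k + 1)%:R * (legendre k).[(2 * x + 1)%:~R] ^+ 4)
    (p%:R + p%:R ^+ 2 *
       (((2 * x + 1)%:~R ^+ 2 * fermat_quotient p (2 * x + 1)) /
        (2 * x%:~R * (x%:~R + 1)))).
Proof.
move=> p_pr p_gt3 Ndvd; apply: in_pow_eqmod => //.
have p_odd : odd p by case: (even_prime p_pr) => // p2; rewrite p2 in p_gt3.
have N2 : ~~ (p%:Z %| 2)%Z by rewrite dvdzE; apply/negP=> /dvdn_leq; lia.
have {Ndvd} [Nxx1 Nw] : ~~ (p%:Z %| x * (x + 1))%Z /\ ~~ (p%:Z %| 2 * x + 1)%Z.
  by apply/andP; rewrite -negb_or -prime_dvdzM.
have N4y : ~~ (p%:Z %| 2 * 2 * (x * (x + 1)))%Z.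
  by rewrite !prime_dvdzM // (negPf N2) -prime_dvdzM.
have p0 : p%:R != 0 :> rat by rewrite pnatr_eq0 -lt0n prime_gt0.
have y0 := ndvdz_neq0 _ _ N4y.
have := sum_legendre4_in_pow p p_pr x p_odd.
set u : rat := x%:~R.
have wE : (2 * x + 1)%:~R = 2 * u + 1 :> rat by rewrite intrD intrM.
have yE : (2 * 2 * (x * (x + 1)))%:~R = 4 * (u * (u + 1)) :> rat.
  by rewrite !intrM intrD; ring.
rewrite wE; rewrite yE in y0.
set S := (X in X - _); set q := fermat_quotient _ _; set w := 2 * u + 1 => congS.
have qE : w ^+ p.-1 = 1 + p%:R * q by rewrite /q /fermat_quotient wE -/w; field.
have q_int : in_pow p 0 q.
  apply: (in_pow_cancel _ p_pr _ _ _ Nw); rewrite wE -/w.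
  have [b E] := fermat_int p p_pr (2 * x + 1) p_odd.
  suff -> : w * q = b%:~R by exact: in_pow_int.
  apply: (mulfI p0); rewrite -E wE -/w -{2}(prednK (prime_gt0 p_pr)) exprS qE; ring.
have z0 : u * (u + 1) != 0 by apply: contraNneq y0 => ->; rewrite mulr0.
have A_E : \sum_(0 <= d < p) 'C(p, d.+1)%:R * (4 * (u * (u + 1))) ^+ d
     = (w ^+ 2 * (1 + p%:R * q) ^+ 2 - 1) / (4 * (u * (u + 1))).
  apply: (mulfI y0); rewrite sum_bin_shift [RHS]mulrC divfK //.
  have -> : 1 + 4 * (u * (u + 1)) = w ^+ 2 by rewrite /w; ring.
  by rewrite -qE -exprMn -exprS prednK ?prime_gt0 // exprAC.
rewrite A_E in congS.
have -> : S - (p%:R + p%:R ^+ 2 * (w ^+ 2 * q / (2 * u * (u + 1))))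
  = (S - p%:R * ((w ^+ 2 * (1 + p%:R * q) ^+ 2 - 1) / (4 * (u * (u + 1)))))
    + p%:R ^+ 3 * (w ^+ 2 * q ^+ 2 / (4 * (u * (u + 1)))).
  move: z0; rewrite mulf_eq0 negb_or => /andP[u0 u10].
  by rewrite /w; field; rewrite u0 u10.
apply: in_powD => //; apply: (in_powM _ p_pr 3 0); first exact: in_pow_pX.
rewrite -yE; apply: in_powMl => //; last exact: in_pow_inv.
apply: in_powMl => //; last exact: in_powX.
by apply: in_powX => //; rewrite /w -wE; exact: in_pow_int.
Qed.
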